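(* The functor $I$ of idempotent probability measures, acting in the category of compact Hausdorff spaces and continuous maps, is normal.
   Context: For a compact Hausdorff space $X$, $C(X)$ is the Banach space of continuous real-valued functions on $X$ with the sup-norm; $c_X\in C(X)$ is the constant function with value $c\in\mathbb R$; $c\odot\varphi=c_X+\varphi$ for $c\in\mathbb R$, $\varphi\in C(X)$, and $\varphi\oplus\psi=\max\{\varphi,\psi\}$ (pointwise); for real numbers $a\odot b=a+b$, $a\oplus b=\max\{a,b\}$. An idempotent probability measure on $X$ is a functional $\mu\colon C(X)\to\mathbb R$ such that $\mu(c_X)=c$, $\mu(c\odot\varphi)=c\odot\mu(\varphi)$ and $\mu(\varphi\oplus\psi)=\mu(\varphi)\oplus\mu(\psi)$ for all $c\in\mathbb R$, $\varphi,\psi\in C(X)$. $I(X)$ is the set of all idempotent probability measures on $X$ with the weak* topology, whose base consists of the sets $\{\nu\in I(X)\mid |\mu(\varphi_i)-\nu(\varphi_i)|<\varepsilon,\ i=1,\dots,n\}$, where $\mu\in I(X)$, $\varphi_1,\dots,\varphi_n\in C(X)$, $\varepsilon>0$; the space $I(X)$ is compact Hausdorff. For a continuous map $f\colon X\to Y$ of compact Hausdorff spaces, $I(f)\colon I(X)\to I(Y)$ is defined by $I(f)(\mu)(\varphi)=\mu(\varphi\circ f)$, $\varphi\in C(Y)$. This makes $I$ a covariant endofunctor of the category of compact Hausdorff spaces and continuous maps. A covariant endofunctor $F$ of this category is called normal if: (1) $F$ is continuous: for every inverse system $\mathcal S=\{X_\alpha,p_{\alpha\beta};\mathcal A\}$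 of compact Hausdorff spaces over a directed set $\mathcal A$, with limit $X=\varprojlim\mathcal S$ and limit projections $p_\alpha\colon X\to X_\alpha$, the map $(F(p_\alpha))_{\alpha\in\mathcal A}\colon F(X)\to\varprojlim\{F(X_\alpha),F(p_{\alpha\beta});\mathcal A\}$ is a homeomorphism; (2) $F$ preserves weight: $w(F(X))=w(X)$ for every infinite compact Hausdorff space $X$, where $w$ denotes the weight of a topological space; (3) $F$ preserves singletons and the empty set: $F(X)$ is a singleton if $X$ is a singleton, and $F(\emptyset)=\emptyset$; (4) $F$ preserves onto maps: $F(f)$ is onto whenever $f$ is onto; (5) $F$ preserves embeddings: $F(f)$ is an embedding whenever $f$ is an embedding (for a closed subset $A\subset X$ with inclusion $i\colon A\to X$, one then identifies $F(A)$ with $F(i)(F(A))\subset F(X)$); (6) $F$ preserves intersections: $F(A\cap B)=F(A)\cap F(B)$ for all closed subsets $A,B$ of a compact Hausdorff space $X$; (7) $F$ preserves preimages: $F(f^{-1}(B))=F(f)^{-1}(F(B))$ for every continuous map $f\colon X\to Y$ of compact Hausdorff spaces and every closed subset $B\subset Y$. *)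

(* Defs.v *)
From HB Require Import structures.
From mathcomp Require Import all_boot all_order all_algebra.
From mathcomp Require Import all_classical all_reals all_analysis.
Import Order.TTheory GRing.Theory Num.Theory numFieldNormedType.Exports.

Set Implicit Arguments.
Unset Strict Implicit.
Unset Printing Implicit Defensive.

Local Open Scope classical_set_scope.
Local Open Scope ring_scope.

(* Spaces are not assumed pointed, so the empty space is included. *)
Record compHaus := CompHaus {
  ch_space :> topologicalType;
  ch_compact : compact [set: ch_space];
  ch_hausdorff : hausdorff_space ch_space }.

Lemma set_type_compact (T : topologicalType) (A : set T) :
  compact A -> compact [set: A].
Proof.
move=> cA F PF _.
have FA : (set_val @ F) A.
  by apply: (@filterE _ F) => x; apply: set_valP.
have [p [Ap clp]] := cA (set_val @ F) _ FA.
exists (exist _ p (mem_set Ap)); split=> // P Q FP [_ [[W oW <-] Wp WQ]].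
have FP' : (set_val @ F) (set_val @` P).
  by apply: (@filterS _ F _ P _ _ FP) => x Px; exists x.
have nW : nbhs p W by apply: open_nbhs_nbhs; split.
have [_ [[y Py <-] Wy]] := clp _ _ FP' nW.
by exists y; split=> //; apply: WQ.
Qed.

Lemma set_type_hausdorff (T : topologicalType) (A : set T) :
  hausdorff_space T -> hausdorff_space A.
Proof.
move=> hT p q clpq; apply: val_inj; apply: hT => P Q nP nQ.
have [z [Pz Qz]] := clpq _ _ (@initial_continuous A T set_val p _ nP)
  (@initial_continuous A T set_val q _ nQ).
by exists (set_val z).
Qed.

Definition closed_sub (X : compHaus) (A : set X) (cA : closed A) : compHaus :=
  CompHaus
    (set_type_compact (subclosed_compact cA (@ch_compact X) (@subsetT _ A)))
    (set_type_hausdorff (@ch_hausdorff X)).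

Definition closed_incl (X : compHaus) (A : set X) (cA : closed A) :
  continuousType (closed_sub cA) X :=
  mkcts (@initial_continuous A X set_val).

Lemma closed_preimage (X Y : compHaus) (f : continuousType X Y) (B : set Y) :
  closed B -> closed (f @^-1` B).
Proof. by apply: preimage_closed => x _; exact: cts_fun. Qed.
Arguments closed_preimage {X Y} f {B} cB.

Definition homeomorphism (S T : topologicalType) (f : S -> T) :=
  continuous f /\ exists g : T -> S, [/\ continuous g, cancel f g & cancel g f].

Definition embedding (S T : topologicalType) (f : S -> T) :=
  [/\ continuous f, injective f &
      forall U : set S, open U ->
        exists2 V : set T, open V & f @` U = V `&` range f].

Definition min_basis (T : topologicalType) (B : set (set T)) :=
  basis B /\ forall B' : set (set T), basis B' -> (B #<= B')%card.

(* A [min_basis] attains the least cardinality of a base, which is the weight;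
   any two of them are equipotent. *)
Definition same_weight (S T : topologicalType) :=
  exists (B : set (set S)) (C : set (set T)),
    [/\ min_basis B, min_basis C & (B #= C)%card].

Definition directed d (A : preorderType d) :=
  (exists a : A, True) /\
  forall a b : A, exists c : A, (a <= c)%O /\ (b <= c)%O.

Record inverse_system d (A : preorderType d) := InverseSystem {
  sys_obj :> A -> compHaus;
  sys_map : forall a b : A, (a <= b)%O ->
    continuousType (sys_obj b) (sys_obj a);
  sys_map_id : forall (a : A) (h : (a <= a)%O), sys_map h =1 idfun;
  sys_map_comp : forall (a b c : A) (hab : (a <= b)%O) (hbc : (b <= c)%O)
    (hac : (a <= c)%O), sys_map hab \o sys_map hbc =1 sys_map hac }.

Section InverseLimit.
Context d (A : preorderType d) (S : inverse_system A).

Definition threads : set (prod_topology (fun a => S a)) :=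
  [set x | forall (a b : A) (h : (a <= b)%O), sys_map S h (x b) = x a].

Let prod_hausdorff : hausdorff_space (prod_topology (fun a => S a)).
Proof. by apply: hausdorff_product => a; exact: ch_hausdorff. Qed.

Let prod_compact : compact [set: prod_topology (fun a => S a)].
Proof.
have := @tychonoff A (fun a => S a) (fun=> setT) (fun a => @ch_compact (S a)).
by congr compact; apply/seteqP; split.
Qed.

Let threads_closed : closed threads.
Proof.
have -> : threads = \bigcap_(t in [set t : A * A | (t.1 <= t.2)%O])
    [set x : prod_topology (fun a => S a) |
      forall h : (t.1 <= t.2)%O, sys_map S h (x t.2) = x t.1].
  apply/seteqP; split=> x xS; first by move=> t _ h; exact: xS.
  by move=> a b h; exact: (xS (a, b) h h).
apply: closed_bigI => -[a b] /= hab x clx h.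
apply: (@ch_hausdorff (S a)) => P Q nP nQ.
have n1 : nbhs x [set y : prod_topology (fun a => S a) |
    P (sys_map S h (y b))].
  apply: (@proj_continuous A (fun a => S a) b x
    [set z | P (sys_map S h z)]).
  exact: (@cts_fun _ _ (sys_map S h) (x b) P nP).
have n2 : nbhs x [set y : prod_topology (fun a => S a) | Q (y a)].
  exact: (@proj_continuous A (fun a => S a) a x Q nQ).
have [y [yE [Py Qy]]] := clx _ (filterI n1 n2).
by exists (y a); split=> //; rewrite -(yE h).
Qed.

Definition invlim : compHaus := CompHaus
  (set_type_compact (subclosed_compact threads_closed prod_compact
     (@subsetT _ threads)))
  (@set_type_hausdorff _ threads prod_hausdorff).

Lemma invlim_proj_cts (a : A) :
  continuous (fun x : invlim => (set_val x : prod_topology (fun a => S a)) a).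
Proof.
move=> x U nU; apply: (@initial_continuous threads _ set_val x
  [set y : prod_topology (fun a => S a) | U (y a)]).
exact: (@proj_continuous A (fun a => S a) a (set_val x) U nU).
Qed.

Definition invlim_proj (a : A) : continuousType invlim (S a) :=
  mkcts (@invlim_proj_cts a).

Lemma invlim_projP (a b : A) (h : (a <= b)%O) :
  sys_map S h \o invlim_proj b =1 invlim_proj a.
Proof. by move=> x; exact: (set_valP x). Qed.

End InverseLimit.
Arguments threads {d A} S.

Record compHausFunctor := CompHausFunctor {
  fobj :> compHaus -> compHaus;
  fmor : forall X Y : compHaus,
    continuousType X Y -> continuousType (fobj X) (fobj Y);
  fmor_id : forall X : compHaus, fmor (@idfun X) =1 idfun;
  fmor_comp : forall (X Y Z : compHaus) (f : continuousType X Y)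
    (g : continuousType Y Z), fmor (g \o f) =1 fmor g \o fmor f }.

Section FunctorInverseSystem.
Context (F : compHausFunctor) d (A : preorderType d) (S : inverse_system A).

Let F_sys_id (a : A) (h : (a <= a)%O) : fmor F (sys_map S h) =1 idfun.
Proof.
have -> : sys_map S h = idfun by apply/continuousEP; exact: sys_map_id.
exact: fmor_id.
Qed.

Let F_sys_comp (a b c : A) (hab : (a <= b)%O) (hbc : (b <= c)%O)
  (hac : (a <= c)%O) :
  fmor F (sys_map S hab) \o fmor F (sys_map S hbc) =1 fmor F (sys_map S hac).
Proof.
have <- : sys_map S hab \o sys_map S hbc = sys_map S hac :> continuousType _ _.
  by apply/continuousEP; exact: sys_map_comp.
by move=> x; rewrite fmor_comp.
Qed.

Definition F_sys : inverse_system A :=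
  @InverseSystem d A (fun a => F (S a)) (fun a b h => fmor F (sys_map S h))
    F_sys_id F_sys_comp.

Lemma F_threads (z : F (invlim S)) :
  threads F_sys (fun a => fmor F (invlim_proj S a) z).
Proof.
move=> a b h /=.
have <- : sys_map S h \o invlim_proj S b = invlim_proj S a
    :> continuousType _ _ by apply/continuousEP; exact: invlim_projP.
by rewrite fmor_comp.
Qed.

Definition F_invlim_map (z : F (invlim S)) : invlim F_sys :=
  exist _ (fun a => fmor F (invlim_proj S a) z) (mem_set (F_threads z)).

End FunctorInverseSystem.
Arguments F_invlim_map F {d A} S z.

(* [F(A)] is identified with its image in [F(X)] under [F] of the inclusion. *)
Definition F_closed (F : compHausFunctor) (X : compHaus) (A : set X)
  (cA : closed A) : set (F X) := range (fmor F (closed_incl cA)).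
Arguments F_closed F {X A} cA.

Record normal_functor (F : compHausFunctor) : Prop := NormalFunctor {
  normal_continuous : forall d (A : preorderType d) (S : inverse_system A),
    directed A -> homeomorphism (F_invlim_map F S);
  normal_weight : forall X : compHaus, infinite_set [set: X] ->
    same_weight (F X) X;
  normal_singleton : forall X : compHaus,
    (exists x : X, [set: X] = [set x]) ->
    exists y : F X, [set: F X] = [set y];
  normal_empty : forall X : compHaus, [set: X] = set0 -> [set: F X] = set0;
  normal_onto : forall (X Y : compHaus) (f : continuousType X Y),
    set_surj [set: X] [set: Y] f -> set_surj [set: F X] [set: F Y] (fmor F f);
  normal_embedding : forall (X Y : compHaus) (f : continuousType X Y),
    embedding f -> embedding (fmor F f);
  normal_intersection : forall (X : compHaus) (A B : set X)
    (cA : closed A) (cB : closed B),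
    F_closed F (closedI cA cB) = F_closed F cA `&` F_closed F cB;
  normal_preimage : forall (X Y : compHaus) (f : continuousType X Y)
    (B : set Y) (cB : closed B),
    F_closed F (closed_preimage f cB) =
    fmor F f @^-1` F_closed F cB }.

Section IdempotentMeasures.
Variable R : realType.

Lemma cvg_maxr (T : Type) (F : set_system T) (FF : Filter F) (f g : T -> R)
  (a b : R) : f x @[x --> F] --> a -> g x @[x --> F] --> b ->
  Num.max (f x) (g x) @[x --> F] --> Num.max a b.
Proof.
move=> fa gb; rewrite maxr_absE; under eq_fun do rewrite maxr_absE.
apply: cvgM; last exact: cvg_cst.
apply: cvgD; first by apply: cvgD.
by apply: cvg_norm; apply: cvgB.
Qed.

Section Space.
Variable X : compHaus.

Local Notation C := (continuousType X R).

Lemma fun_odot_cts (c : R) (phi : C) : continuous (fun x => c + phi x).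
Proof. by move=> x; apply: cvgD; [exact: cvg_cst|exact: cts_fun]. Qed.

Lemma fun_oplus_cts (phi psi : C) : continuous (fun x => Num.max (phi x) (psi x)).
Proof. by move=> x; apply: cvg_maxr; exact: cts_fun. Qed.

Definition fun_cst (c : R) : C := cst c.
Definition fun_odot (c : R) (phi : C) : C := mkcts (@fun_odot_cts c phi).
Definition fun_oplus (phi psi : C) : C := mkcts (@fun_oplus_cts phi psi).

Record idem_measure := IdemMeasure {
  idem_val :> C -> R;
  idem_cst : forall c : R, idem_val (fun_cst c) = c;
  idem_odot : forall (c : R) (phi : C),
    idem_val (fun_odot c phi) = c + idem_val phi;
  idem_oplus : forall phi psi : C,
    idem_val (fun_oplus phi psi) = Num.max (idem_val phi) (idem_val psi) }.

HB.instance Definition _ := gen_eqMixin idem_measure.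
HB.instance Definition _ := gen_choiceMixin idem_measure.

Lemma idem_measureP (mu nu : idem_measure) : mu =1 nu -> mu = nu.
Proof.
case: mu nu => [m a b c] [n a' b' c'] /= /funext mn; subst n.
by congr IdemMeasure; exact: Prop_irrelevance.
Qed.

Definition weak_nbhd (mu : idem_measure) (n : nat) (phi : 'I_n -> C) (e : R) :
  set idem_measure := [set nu | forall i, `|mu (phi i) - nu (phi i)| < e].

Definition weak_base : set (set idem_measure) :=
  [set U | exists mu n (phi : 'I_n -> C) (e : R),
    0 < e /\ U = weak_nbhd mu phi e].

Let weak_base_cover : \bigcup_(U in weak_base) U = setT.
Proof.
apply/seteqP; split=> // mu _; exists (weak_nbhd mu (fun _ : 'I_0 => fun_cst 0) 1).
  by exists mu, 0%N, (fun _ : 'I_0 => fun_cst 0), 1.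
by case.
Qed.

Let weak_nbhd_center (mu nu : idem_measure) n (phi : 'I_n -> C) (e : R) :
  weak_nbhd mu phi e nu ->
  exists2 r : R, 0 < r & weak_nbhd nu phi r `<=` weak_nbhd mu phi e.
Proof.
move=> muenu; pose r := \big[Num.min/1]_(i < n) (e - `|mu (phi i) - nu (phi i)|).
exists r.
  by apply: lt_bigmin => // i _; rewrite subr_gt0.
move=> la nula i; have ri : r <= e - `|mu (phi i) - nu (phi i)|.
  exact: bigmin_le_cond.
have := lt_le_trans (nula i) ri; rewrite ltrBrDl; apply: le_lt_trans.
by rewrite -[in X in X <= _](subrK (nu (phi i)) (mu (phi i))) -addrA ler_normD.
Qed.

Let weak_base_join (U V : set idem_measure) (nu : idem_measure) :
  weak_base U -> weak_base V -> U nu -> V nu ->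
  exists W, [/\ weak_base W, W nu & W `<=` U `&` V].
Proof.
move=> [m1 [n1 [p1 [e1 [e10 ->]]]]] [m2 [n2 [p2 [e2 [e20 ->]]]]].
move=> /weak_nbhd_center[r1 r10 s1] /weak_nbhd_center[r2 r20 s2].
pose p (i : 'I_(n1 + n2)) : C :=
  match fintype.split i with inl j => p1 j | inr j => p2 j end.
have r0 : 0 < Num.min r1 r2 by rewrite lt_min r10.
exists (weak_nbhd nu p (Num.min r1 r2)); split.
- by exists nu, (n1 + n2)%N, p, (Num.min r1 r2).
- by move=> i; rewrite subrr normr0.
- move=> la nula; split; [apply: s1 => i|apply: s2 => i].
    have := nula (unsplit (inl i)); rewrite /p unsplitK lt_min.
    by case/andP.
  have := nula (unsplit (inr i)); rewrite /p unsplitK lt_min.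
  by case/andP.
Qed.

HB.instance Definition _ := @isBaseTopological.Build idem_measure
  (set idem_measure) weak_base id weak_base_cover weak_base_join.

Lemma weak_nbhd_nbhs (mu nu : idem_measure) n (phi : 'I_n -> C) (e : R) :
  0 < e -> weak_nbhd mu phi e nu -> nbhs nu (weak_nbhd mu phi e).
Proof.
move=> e0 munu; apply: open_nbhs_nbhs; split=> //.
exists [set weak_nbhd mu phi e]; last by rewrite bigcup_set1.
by move=> _ ->; exists mu, n, phi, e.
Qed.

Lemma nbhs_weakP (nu : idem_measure) (U : set idem_measure) : nbhs nu U ->
  exists n (phi : 'I_n -> C) (e : R), 0 < e /\ weak_nbhd nu phi e `<=` U.
Proof.
rewrite nbhsE => -[V [[D sD <-] [W DW Wnu]] VU].
have [mu [n [phi [e [e0 WE]]]]] := sD _ DW.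
rewrite /= WE in Wnu; have [r r0 sr] := weak_nbhd_center Wnu.
exists n, phi, r; split=> // la /sr; rewrite -WE => Wla.
by apply: VU; exists W.
Qed.

Lemma idem_eval_cts (phi : C) : continuous (fun mu : idem_measure => mu phi).
Proof.
move=> mu; apply/(@cvgrPdist_lt _ _ _ _ (nbhs_filter mu)) => e e0.
have /weak_nbhd_nbhs : weak_nbhd mu (fun _ : 'I_1 => phi) e mu.
  by move=> i; rewrite subrr normr0.
move=> /(_ e0) nb.
by apply: (@filterS _ (nbhs mu) _ _ _ _ nb) => nu /(_ ord0).
Qed.

Lemma idem_hausdorff : hausdorff_space idem_measure.
Proof.
move=> mu nu munu; apply: idem_measureP => phi.
apply: (@Rhausdorff R) => P Q nP nQ.
have [la [Pla Qla]] := munu _ _ (@idem_eval_cts phi mu _ nP)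
  (@idem_eval_cts phi nu _ nQ).
by exists (la phi).
Qed.

Lemma idem_le (mu : idem_measure) (phi psi : C) :
  (forall x, phi x <= psi x) -> mu phi <= mu psi.
Proof.
move=> le; have -> : psi = fun_oplus phi psi.
  by apply/continuousEP => x /=; rewrite /mkcts max_r.
by rewrite idem_oplus le_max lexx.
Qed.

Lemma cts_bounded (phi : C) : exists M : R, forall x, `|phi x| <= M.
Proof.
have cphi : compact (range phi).
  apply: continuous_compact; last exact: ch_compact.
  by apply: continuous_subspaceT => x; exact: cts_fun.
have [M [_ MP]] := compact_bounded cphi.
by exists (M + 1) => x; apply: (MP (M + 1)); [rewrite ltrDl|exists x].
Qed.

Lemma idem_compact : compact [set: idem_measure].
Proof.
rewrite compact_ultra => F FU _.
have /choice[l lP] : forall phi : C, exists a : R,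
    (fun mu : idem_measure => mu phi) @ F --> a.
  move=> phi; have [M MP] := cts_bounded phi.
  have Fphi : ((fun mu : idem_measure => mu phi) @ F) [set` `[- M, M]].
    apply: (@filterE _ F) => mu; rewrite /= in_itv/=; apply/andP; split.
      rewrite -[leLHS](idem_cst mu); apply: idem_le => x /=.
      by have := MP x; rewrite ler_norml => /andP[].
    rewrite -[leRHS](idem_cst mu); apply: idem_le => x /=.
    by have := MP x; rewrite ler_norml => /andP[].
  have UF : UltraFilter ((fun mu : idem_measure => mu phi) @ F).
    split; first exact: fmap_proper_filter.
    move=> G PG FG; apply/seteqP; split=> [A GA|]; last exact: FG.
    have [//|FnA] := in_ultra_setVsetC (fun mu : idem_measure => A (mu phi)) FU.
    have GnA : G (~` A) by apply: FG.
    by have [x [Ax]] := filter_ex (filterI GA GnA).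
  have := @segment_compact R (- M) M.
  rewrite compact_ultra => /(_ _ UF Fphi)[a [_ Fa]].
  by exists a; exact: Fa.
have lE phi a : (fun mu : idem_measure => mu phi) @ F --> a -> l phi = a.
  by move=> Fa; apply: (cvg_unique (@Rhausdorff R) (lP phi) Fa).
have l1 c : l (fun_cst c) = c.
  apply: lE; rewrite (_ : (fun mu => _) = cst c); first exact: cvg_cst.
  by apply/funext => mu; rewrite idem_cst.
have l2 c phi : l (fun_odot c phi) = c + l phi.
  apply: lE; rewrite (_ : (fun mu => _) = (fun mu : idem_measure => c + mu phi)).
    by apply: cvgD; [exact: cvg_cst|exact: lP].
  by apply/funext => mu; rewrite idem_odot.
have l3 phi psi : l (fun_oplus phi psi) = Num.max (l phi) (l psi).
  apply: lE; rewrite (_ : (fun mu => _) =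
      (fun mu : idem_measure => Num.max (mu phi) (mu psi))).
    by apply: cvg_maxr; exact: lP.
  by apply/funext => mu; rewrite idem_oplus.
exists (IdemMeasure l1 l2 l3); split=> // U /nbhs_weakP[n [phi [e [e0 sU]]]].
apply: filterS sU _.
apply: filter_forall => i.
by have /cvgrPdist_lt := lP (phi i); apply.
Qed.

Definition idem_space : compHaus := CompHaus idem_compact idem_hausdorff.

End Space.

Section Map.
Variables (X Y : compHaus) (f : continuousType X Y).

Definition idem_push_val (mu : idem_space X) (phi : continuousType Y R) : R :=
  (mu : idem_measure X) (phi \o f).

Let push_cst mu c : idem_push_val mu (fun_cst Y c) = c.
Proof.
rewrite -[RHS](idem_cst mu) /idem_push_val; congr (idem_val mu _).
exact/continuousEP.
Qed.

Let push_odot mu c phi :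
  idem_push_val mu (fun_odot c phi) = c + idem_push_val mu phi.
Proof.
rewrite -[RHS]idem_odot /idem_push_val; congr (idem_val mu _).
exact/continuousEP.
Qed.

Let push_oplus mu phi psi : idem_push_val mu (fun_oplus phi psi) =
  Num.max (idem_push_val mu phi) (idem_push_val mu psi).
Proof.
rewrite -[RHS]idem_oplus /idem_push_val; congr (idem_val mu _).
exact/continuousEP.
Qed.

Definition idem_push (mu : idem_space X) : idem_space Y :=
  IdemMeasure (push_cst mu) (push_odot mu) (push_oplus mu).

Lemma idem_push_cts : continuous idem_push.
Proof.
move=> mu U /nbhs_weakP[n [phi [e [e0 sU]]]].
have mumu : weak_nbhd mu (fun i => phi i \o f : continuousType X R) e mu.
  by move=> i; rewrite subrr normr0.
apply: (@filterS _ (nbhs mu) _ _ _ _ (weak_nbhd_nbhs e0 mumu)) => nu nuP.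
exact: sU.
Qed.

Definition idem_map : continuousType (idem_space X) (idem_space Y) :=
  mkcts idem_push_cts.

End Map.

Lemma idem_map_id (X : compHaus) : idem_map (@idfun X) =1 idfun.
Proof.
move=> mu; apply: idem_measureP => phi /=.
by rewrite /idem_push_val; congr (idem_val mu _); exact/continuousEP.
Qed.

Lemma idem_map_comp (X Y Z : compHaus) (f : continuousType X Y)
  (g : continuousType Y Z) : idem_map (g \o f) =1 idem_map g \o idem_map f.
Proof.
move=> mu; apply: idem_measureP => phi /=.
by rewrite /idem_push_val; congr (idem_val mu _); exact/continuousEP.
Qed.

Definition idem_functor : compHausFunctor :=
  CompHausFunctor idem_map_id idem_map_comp.

End IdempotentMeasures.

(* Main.v *)
From mathcomp Require Import all_boot all_order all_algebra.
Require Import Defs.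
From mathcomp Require Import all_classical all_reals all_analysis.
Import Order.TTheory GRing.Theory Num.Theory numFieldNormedType.Exports.

Set Implicit Arguments.
Unset Strict Implicit.
Unset Printing Implicit Defensive.

Local Open Scope classical_set_scope.
Local Open Scope ring_scope.

(** The main tool is an elementary Hahn-Banach theorem ([idem_extension]): a
    monotone functional given on part of [C(X)], compatible with constants,
    shifts and maxima, extends to an idempotent measure. Preservation of onto
    maps follows by extending from the functions [psi \o f], and the same lemma,
    applied to the restrictions of functions to a closed set [A], shows that
    [I(A)], seen inside [I(X)], consists of the measures supported by [A]
    ([F_closed_supported]). Intersections and preimages then are two cases of
    one statement on supports ([supported_preimage]).

    In the other direction, an idempotent measure is determined by its values
    on peaks, which are functions [g <= 0] with [g x = 0] that are very negative
    off a neighbourhood of [x] ([idem_eq_peaks]). When [f] is injective there are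
    enough peaks of the form [h \o f], so [I(f)] is injective, and by compactness
    it is an embedding.

    For an inverse limit, peaks that factor through one of the projections give
    injectivity of the comparison map. Surjectivity is an extension again: a
    thread of measures defines a functional on the functions that factor through
    a projection, which is monotone because an open set that contains the image
    of the limit contains the image of some stage ([invlim_proj_eventually]).

    For the weight, [X] embeds into [I(X)] by Dirac measures, so every base of
    [I(X)] induces one of [X] that is not larger. Conversely, the Urysohn peaks
    for pairs of sets from a base [B] of [X], compared with rational numbers,
    define a subbase of [I(X)]; as [B] is infinite, the resulting base is not
    larger than [B], by the theorem that an infinite set is equipotent to its
    square ([infinite_card_square]). *)

(** * Compact Hausdorff spaces *)

(** Otherwise the sets with a complement satisfying [P] form a proper filter;
    at a cluster point of it, no neighbourhood satisfies [P]. *)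
Lemma compact_induction (X : topologicalType) (P : set X -> Prop) :
  compact [set: X] -> P set0 ->
  (forall U V, U `<=` V -> P V -> P U) ->
  (forall U V, P U -> P V -> P (U `|` V)) ->
  (forall x : X, exists2 U, nbhs x U & P U) -> P setT.
Proof.
move=> cX P0 Ple PU Ploc; apply: contrapT => nPT.
pose F : set_system X := [set A | P (~` A)].
have FF : ProperFilter F.
  split; first by rewrite /F /= setC0.
  split; first by rewrite /F /= setCT.
    by move=> A B PA PB; rewrite /F /= setCI; exact: PU.
  by move=> A B AB; apply: Ple; exact: subsetC.
have [x [_ clx]] := cX F FF (filterT : F setT).
have [U nU PUx] := Ploc x.
have FU : F (~` U) by rewrite /F /= setCK.
by have [y [nUy Uy]] := clx _ _ FU nU.
Qed.

(** A family of open sets that is closed under finite intersections and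
    separates points already generates the topology, as no Hausdorff topology
    is strictly coarser than a compact one. *)
Lemma separating_basis (X : compHaus) (B : set (set X)) :
  B `<=` open -> B setT -> setI_closed B ->
  (forall x y : X, x <> y ->
    exists U V, [/\ B U, B V, U x, V y & U `&` V = set0]) ->
  basis B.
Proof.
move=> Bo BT BI Bsep; split=> // x W; rewrite nbhsE => -[W' [oW' W'x] W'W].
suff [V [BV Vx VW]] : exists V, [/\ B V, V x & V `&` setT `<=` W'].
  by exists V => // y Vy; apply/W'W/VW.
apply: (@compact_induction X (fun S => exists V, [/\ B V, V x & V `&` S `<=` W'])).
- exact: ch_compact.
- by exists setT; split=> //; rewrite setI0.
- move=> S S' SS' [V [BV Vx VW]]; exists V; split=> //.
  by apply: subset_trans VW; exact: setIS.
- move=> S S' [V [BV Vx VW]] [V' [BV' V'x VW']]; exists (V `&` V'); split=> //.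
    exact: BI.
  by move=> y [[Vy V'y] [Sy|S'y]]; [exact: VW|exact: VW'].
move=> y; have [W'y|W'y] := pselect (W' y).
  exists W'; first exact: open_nbhs_nbhs.
  by exists setT; split=> // z [].
have [U [V [BU BV Ux Vy UV]]] : exists U V, [/\ B U, B V, U x, V y & U `&` V = set0].
  by apply: Bsep => xy; apply: W'y; rewrite -xy.
exists V; first by apply: open_nbhs_nbhs; split=> //; exact: Bo.
by exists U; split=> //; rewrite UV.
Qed.

Lemma continuous_image_closed (X Y : compHaus) (f : X -> Y) (A : set X) :
  continuous f -> closed A -> closed (f @` A).
Proof.
move=> cf cA; apply: compact_closed; first exact: ch_hausdorff.
apply: continuous_compact; first exact: continuous_subspaceT.
by apply: (subclosed_compact cA (@ch_compact X)).
Qed.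

Lemma inj_continuous_embedding (X Y : compHaus) (f : X -> Y) :
  continuous f -> injective f -> embedding f.
Proof.
move=> cf fI; split=> // U oU; exists (~` (f @` (~` U))).
  by apply/closed_openC/continuous_image_closed => //; exact: open_closedC.
apply/seteqP; split=> [_ [x Ux <-]|y [nfy [x _ fxy]]].
  by split; [move=> [y nUy /fI yx]; apply: nUy; rewrite yx|exists x].
by exists x => //; apply: contrapT => nUx; apply: nfy; exists x.
Qed.

Lemma bij_continuous_homeomorphism (X Y : compHaus) (f : X -> Y) :
  continuous f -> injective f -> (forall y, exists x, f x = y) ->
  homeomorphism f.
Proof.
move=> cf fI /choice[g gK]; split=> //; exists g; split=> //; last first.
  by move=> x; apply: fI; rewrite gK.
apply/continuousP => U oU.
have -> : g @^-1` U = ~` (f @` (~` U)).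
  apply/seteqP; split=> [y Ugy [x nUx fxy]|y nfy].
    by apply: nUx; rewrite (fI x (g y))// gK.
  by apply: contrapT => nUgy; apply: nfy; exists (g y).
by apply/closed_openC/continuous_image_closed => //; exact: open_closedC.
Qed.

Lemma compHaus_normal (X : compHaus) : normal_space X.
Proof. by apply: compact_normal; [exact: ch_hausdorff|exact: ch_compact]. Qed.

Lemma urysohn_compHaus (R : realType) (X : compHaus) (A B : set X) (a b : R) :
  closed A -> closed B -> A `&` B = set0 -> a < b ->
  exists f : continuousType X R, [/\ forall x, A x -> f x = a,
    forall x, B x -> f x = b & forall x, a <= f x <= b].
Proof.
move=> cA cB AB ab.
have [f [cf fA fB fr]] := urysohn_ext_itv (@compHaus_normal X) cA cB AB ab.
exists (mkcts cf); split=> x; first by move=> Ax; apply: fA; exists x.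
  by move=> Bx; apply: fB; exists x.
by have := fr (f x); rewrite /= in_itv /=; apply; exists x.
Qed.

Lemma closed_point (X : compHaus) (x : X) : closed [set x].
Proof.
by apply: accessible_closed_set1; apply: hausdorff_accessible; exact: ch_hausdorff.
Qed.

(** These peaks play the role of the indicator of a point in max-plus
    analysis, where [0] is the unit and very negative values are nearly zero. *)
Lemma urysohn_peak (R : realType) (X : compHaus) (x : X) (U : set X) (N : R) :
  open_nbhs x U -> exists g : continuousType X R,
    [/\ g x = 0, forall y, g y <= 0 & forall y, ~ U y -> g y <= - N].
Proof.
move=> [oU Ux].
have [||||g [gU gx gle]] := @urysohn_compHaus R X (~` U) [set x] (- (`|N| + 1)) 0.
- exact: open_closedC.
- exact: closed_point.
- by apply/seteqP; split=> // y [nUy yx]; apply: nUy; rewrite yx.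
- by rewrite oppr_lt0 ltr_wpDl.
exists g; split=> [|y|y nUy]; first exact: gx.
  by have /andP[] := gle y.
by rewrite gU// lerN2 (le_trans (ler_norm N))// lerDl.
Qed.

Lemma compHaus_regular (X : compHaus) (x : X) (U : set X) : nbhs x U ->
  exists2 V, open_nbhs x V & closure V `<=` U.
Proof.
move=> nU; have [|V nV VU] := @compact_regular X x setT (@ch_hausdorff X)
  (@ch_compact X) _ U nU; first exact: filterT.
exists V°; first by split; [exact: open_interior|].
by apply: subset_trans VU; apply: closureS; exact: interior_subset.
Qed.

(** * Constructing and comparing idempotent measures *)

(** A partial functional that is compatible with the order and the idempotent
    operations extends to an idempotent measure: the least upper extension
    [phi |-> inf {a | L psi a, phi <= psi}] is additive for [oplus] because
    upper bounds of [phi] and of [phi'] combine to one of their maximum. *)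
Lemma idem_extension (R : realType) (X : compHaus)
    (L : continuousType X R -> R -> Prop) :
  (forall c, L (fun_cst X c) c) ->
  (forall c psi a, L psi a -> L (fun_odot c psi) (c + a)) ->
  (forall psi psi' a a', L psi a -> L psi' a' ->
    L (fun_oplus psi psi') (Num.max a a')) ->
  (forall psi psi' a a', L psi a -> L psi' a' ->
    (forall x, psi x <= psi' x) -> a <= a') ->
  exists mu : idem_measure R X, forall psi a, L psi a -> mu psi = a.
Proof.
move=> Lcst Lodot Loplus Lle.
pose E (phi : continuousType X R) :=
  [set a | exists2 psi, L psi a & forall x, phi x <= psi x].
have E0 phi : E phi !=set0.
  have [M MP] := cts_bounded phi; exists M; exists (fun_cst X M) => // x.
  by have := MP x; rewrite ler_norml => /andP[].
have Elb phi : has_lbound (E phi).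
  have [M MP] := cts_bounded phi; exists (- M) => a [psi La phipsi].
  apply: Lle (Lcst (- M)) La _ => x; apply: le_trans (phipsi x).
  by have := MP x; rewrite ler_norml => /andP[].
pose m phi := inf (E phi).
have m_lb phi a : E phi a -> m phi <= a by move=> Ea; exact: ge_inf.
have m_glb phi t : (forall a, E phi a -> t <= a) -> t <= m phi.
  by move=> tE; apply: lb_le_inf.
have m_le (phi psi : continuousType X R) :
    (forall x, phi x <= psi x) -> m phi <= m psi.
  move=> le; apply: m_glb => a [psi' La psile]; apply: m_lb; exists psi' => // x.
  exact: le_trans (psile x).
have m_ext psi a : L psi a -> m psi = a.
  move=> La; apply/eqP; rewrite eq_le; apply/andP; split.
    by apply: m_lb; exists psi.
  by apply: m_glb => b [psi' Lb le]; exact: Lle La Lb le.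
have m_cst c : m (fun_cst X c) = c by exact: m_ext.
have m_odot c phi : m (fun_odot c phi) = c + m phi.
  apply/eqP; rewrite eq_le; apply/andP; split.
    rewrite -lerBlDl; apply: m_glb => a [psi La le]; rewrite lerBlDl; apply: m_lb.
    by exists (fun_odot c psi); [exact: Lodot|move=> x; rewrite lerD2l].
  apply: m_glb => a [psi La le]; rewrite -lerBrDl addrC; apply: m_lb.
  exists (fun_odot (- c) psi); first exact: Lodot.
  by move=> x /=; rewrite /mkcts addrC lerBrDl; exact: le.
have m_oplus phi psi : m (fun_oplus phi psi) = Num.max (m phi) (m psi).
  apply/eqP; rewrite eq_le; apply/andP; split; last first.
    by rewrite ge_max !m_le// => x /=; rewrite /mkcts le_max lexx ?orbT.
  rewrite leNgt; apply/negP; rewrite gt_max => /andP[lt1 lt2].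
  have [a [p La phip] alt] := inf_lt (E0 phi) lt1.
  have [b [q Lb psiq] blt] := inf_lt (E0 psi) lt2.
  have : m (fun_oplus phi psi) <= Num.max a b.
    apply: m_lb; exists (fun_oplus p q); first exact: Loplus.
    by move=> x /=; rewrite /mkcts ge_max !le_max phip psiq orbT.
  by rewrite leNgt gt_max alt blt.
by exists (IdemMeasure m_cst m_odot m_oplus).
Qed.

(** The functions on which [mu] and [nu] agree are stable under shifts and
    maxima, and by compactness every [phi] is uniformly approximated by maxima
    of finitely many shifted peaks. *)
Lemma idem_eq_peaks (R : realType) (X : compHaus) (mu nu : idem_measure R X) :
  (forall (x : X) U (N : R), nbhs x U -> exists g : continuousType X R,
    [/\ mu g = nu g, g x = 0, forall y, g y <= 0 &
        forall y, ~ U y -> g y <= - N]) ->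
  mu = nu.
Proof.
move=> peaks; apply: idem_measureP => phi.
have [M MP] := cts_bounded phi.
have phiM y : - M <= phi y <= M by rewrite -ler_norml.
suff approx e : 0 < e -> exists psi : continuousType X R, [/\ mu psi = nu psi,
    forall y, psi y <= e + phi y & forall y, phi y <= e + psi y].
  apply/eqP; rewrite eq_le; apply/andP; split; apply/ler_addgt0Pl => e e0;
    have e20 : 0 < e / 2 by [rewrite divr_gt0];
    have [psi [munu le1 le2]] := approx _ e20.
    apply: (@le_trans _ _ (mu (fun_odot (e / 2) psi))); first exact: idem_le.
    rewrite idem_odot munu [e in leRHS]splitr -addrA lerD2l -idem_odot.
    exact: idem_le.
  apply: (@le_trans _ _ (nu (fun_odot (e / 2) psi))); first exact: idem_le.
  rewrite idem_odot -munu [e in leRHS]splitr -addrA lerD2l -idem_odot.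
  exact: idem_le.
move=> e0; suff [psi [munu le1 le2]] : exists psi : continuousType X R,
    [/\ mu psi = nu psi, forall y, psi y <= e + phi y &
        forall y, setT y -> phi y <= e + psi y].
  by exists psi; split=> // y; exact: le2.
apply: (@compact_induction X (fun S => exists psi : continuousType X R,
    [/\ mu psi = nu psi, forall y, psi y <= e + phi y &
        forall y, S y -> phi y <= e + psi y])).
- exact: ch_compact.
- exists (fun_cst X (- M)); split=> //; first by rewrite !idem_cst.
  move=> y /=; have /andP[+ _] := phiM y.
  by move=> /le_trans; apply; rewrite lerDr ltW.
- move=> S S' SS' [psi [munu le1 le2]]; exists psi; split=> // y /SS'.
  exact: le2.
- move=> S S' [psi [munu le1 le2]] [psi' [munu' le1' le2']].
  exists (fun_oplus psi psi'); split; first by rewrite !idem_oplus munu munu'.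
    by move=> y /=; rewrite /mkcts ge_max le1 le1'.
  by move=> y [/le2|/le2'] /le_trans; apply; rewrite lerD2l /= /mkcts le_max lexx ?orbT.
move=> x.
have nU : nbhs x [set y | phi x < e + phi y].
  have : (fun y => e + phi y) @ x --> e + phi x by exact: (@fun_odot_cts _ _ e phi).
  by move=> /cvgr_gt; apply; rewrite ltrDr.
(* off [U] the shifted peak lies below [- M], hence below [phi] *)
have [g [munu gx0 gle gU]] := peaks x _ (M + M) nU.
exists [set y | phi y < e + (phi x + g y)].
  have : (fun y => e + (phi x + g y) - phi y) @ x --> e + (phi x + g x) - phi x.
    apply: cvgB; last exact: cts_fun.
    exact: (@fun_odot_cts _ _ e (fun_odot (phi x) g)).
  have gt0 : 0 < e + (phi x + g x) - phi x by rewrite gx0 addr0 addrK.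
  by move=> /cvgr_gt/(_ _ gt0); apply: filterS => y; rewrite subr_gt0.
exists (fun_odot (phi x) g); split; first by rewrite !idem_odot munu.
- move=> y /=; rewrite /mkcts.
  have [Uy|/gU gy] := pselect (phi x < e + phi y).
    by apply/ltW/(le_lt_trans _ Uy); rewrite gerDl.
  have /andP[lo _] := phiM y; have /andP[_ hi] := phiM x.
  rewrite (le_trans (lerD hi gy))// opprD addrA subrr add0r.
  by rewrite (le_trans lo)// lerDr ltW.
- by move=> y /ltW.
Qed.

Lemma idem_bounds (R : realType) (X : compHaus) (mu : idem_measure R X)
    (phi : continuousType X R) (M : R) :
  (forall x, `|phi x| <= M) -> - M <= mu phi <= M.
Proof.
move=> phiM; rewrite -[X in X <= _](idem_cst mu) -[X in _ <= _ <= X](idem_cst mu).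
by apply/andP; split; apply: idem_le => x /=; have := phiM x;
  rewrite ler_norml => /andP[].
Qed.

Lemma idem_map_surj (R : realType) (X Y : compHaus) (f : continuousType X Y) :
  (forall y, exists x, f x = y) ->
  forall nu : idem_measure R Y, exists mu, idem_map R f mu = nu.
Proof.
move=> fsurj nu.
have [||||mu muP] := @idem_extension R X
  (fun phi a => exists2 psi : continuousType Y R, phi =1 psi \o f & a = nu psi).
- by move=> c; exists (fun_cst Y c) => //; rewrite idem_cst.
- move=> c phi a [psi e ->]; exists (fun_odot c psi); last by rewrite idem_odot.
  by move=> x /=; rewrite /mkcts e.
- move=> phi phi' a a' [psi e ->] [psi' e' ->].
  exists (fun_oplus psi psi'); last by rewrite idem_oplus.
  by move=> x /=; rewrite /mkcts e e'.
- move=> phi phi' a a' [psi e ->] [psi' e' ->] le; apply: idem_le => y.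
  by have [x <-] := fsurj y; have := le x; rewrite e e'.
exists mu; apply: idem_measureP => psi; apply: muP.
by exists psi.
Qed.

Lemma idem_map_inj (R : realType) (X Y : compHaus) (f : continuousType X Y) :
  injective f -> injective (idem_map R f).
Proof.
move=> fI mu nu munu; apply: idem_eq_peaks => x U N nU.
have {nU} [V [oV Vx] VU] : exists2 V, open_nbhs x V & V `<=` U.
  by move: nU; rewrite nbhsE.
have oV' : open_nbhs (f x) (~` (f @` (~` V))).
  split; last by move=> [y nVy /fI yx]; apply: nVy; rewrite yx.
  apply: closed_openC; apply: continuous_image_closed; first exact: cts_fun.
  exact: open_closedC.
have [h [hx hle hV]] := urysohn_peak N oV'.
exists (h \o f); split=> //.
- exact: (congr1 (fun la : idem_measure R Y => la h) munu).
- by move=> y; exact: hle.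
- by move=> y nUy; apply: hV; apply; exists y => //; apply: contra_not nUy => /VU.
Qed.

(** * Supports *)

(** A closed set supports [mu] when the values of a function there determine
    its integral; the monotone form is the convenient one. *)
Definition supported (R : realType) (X : compHaus) (mu : idem_measure R X)
    (A : set X) :=
  forall phi psi : continuousType X R, (forall x, A x -> phi x <= psi x) ->
    mu phi <= mu psi.

(** A measure supported by [A] descends to the restrictions to [A] of the
    continuous functions on [X], and from these it extends to all of [C(A)]. *)
Lemma F_closed_supported (R : realType) (X : compHaus) (A : set X)
    (cA : closed A) (mu : idem_measure R X) :
  F_closed (idem_functor R) cA mu <-> supported mu A.
Proof.
split=> [[nu _ <-] phi psi le|suppA].
  by apply: (@idem_le _ _ nu) => x; apply: le; exact: (set_valP x).
have [||||nu nuP] := @idem_extension R (closed_sub cA)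
  (fun phi a => exists2 psi : continuousType X R,
    phi =1 psi \o closed_incl cA & a = mu psi).
- by move=> c; exists (fun_cst X c) => //; rewrite idem_cst.
- move=> c phi a [psi e ->]; exists (fun_odot c psi); last by rewrite idem_odot.
  by move=> x; rewrite /= /mkcts e.
- move=> phi phi' a a' [psi e ->] [psi' e' ->].
  exists (fun_oplus psi psi'); last by rewrite idem_oplus.
  by move=> x; rewrite /= /mkcts e e'.
- move=> phi phi' a a' [psi e ->] [psi' e' ->] le; apply: suppA => x Ax.
  by have := le (exist _ x (mem_set Ax)); rewrite e e'.
exists nu => //; apply: idem_measureP => psi; apply: nuP.
by exists psi.
Qed.

(** If [phi <= psi] on [A `&` f @^-1` B], let [h] separate [B] from the image
    of the part of [A] where [psi + e <= phi]. Then [phi] is bounded on [A] by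
    the maximum of [psi + e] and [h \o f], and the second function does not
    count because [h] is very negative on [B]. *)
Lemma supported_preimage (R : realType) (X Y : compHaus)
    (f : continuousType X Y) (mu : idem_measure R X) (A : set X) (B : set Y) :
  closed A -> closed B -> supported mu A ->
  supported (idem_map R f mu : idem_measure R Y) B ->
  supported mu (A `&` f @^-1` B).
Proof.
move=> cA cB suppA suppB phi psi le; apply/ler_addgt0Pl => e e0.
have [M1 M1P] := cts_bounded phi; have [M2 M2P] := cts_bounded psi.
pose M := `|M1| + `|M2| + 1.
have M0 : 0 < M by rewrite /M ltr_wpDl// addr_ge0.
have M1M : M1 <= M by rewrite /M -addrA (le_trans (ler_norm _))// lerDl addr_ge0.
have M2M : M2 <= M.
  by rewrite /M addrAC (le_trans (ler_norm _))// lerDr addr_ge0.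
pose K := A `&` [set x | e + psi x <= phi x].
have cK : closed K.
  apply: closedI => //.
  have -> : [set x | e + psi x <= phi x] =
      (fun x => phi x - (e + psi x)) @^-1` [set t | 0 <= t].
    by apply/seteqP; split=> x /=; rewrite subr_ge0.
  apply: preimage_closed; last exact: closed_ge.
  by move=> x _; apply: cvgB; [exact: cts_fun|exact: (@fun_odot_cts _ _ e psi)].
have [|||h [hB hK _]] := @urysohn_compHaus R Y B (f @` K) (- M) M cB.
- by apply: continuous_image_closed => //; exact: cts_fun.
- apply/seteqP; split=> // y [By [x [Ax lex] fx]]; rewrite -fx in By.
  have := le_trans lex (le x (conj Ax By)).
  by rewrite gerDr leNgt e0.
- by rewrite gtrN.
apply: (@le_trans _ _ (mu (fun_oplus (fun_odot e psi) (h \o f)))).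
  apply: suppA => x Ax /=; rewrite /mkcts le_max.
  have [lex|ltx] := leP (e + psi x) (phi x); last by rewrite (ltW ltx).
  rewrite hK ?(le_trans (ler_norm _) (le_trans (M1P x) M1M)) ?orbT//.
  by exists x.
rewrite idem_oplus idem_odot ge_max lexx /=.
have hM : mu (h \o f) <= - M.
  rewrite -[leRHS](idem_cst (idem_map R f mu)); apply: suppB => y By /=.
  by rewrite hB.
apply: (le_trans hM); rewrite -[leLHS]add0r lerD ?(ltW e0)//.
by have /andP[] := idem_bounds mu (fun x => le_trans (M2P x) M2M).
Qed.

(** * Inverse limits *)

Section InverseLimits.
Context d (A : preorderType d) (S : inverse_system A).
Hypothesis dirA : directed A.

Lemma sys_map_irr (a b : A) (h h' : (a <= b)%O) : sys_map S h =1 sys_map S h'.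
Proof. by move=> x; rewrite (bool_irrelevance h h'). Qed.

Lemma invlim_eqP (x y : invlim S) :
  (forall a, invlim_proj S a x = invlim_proj S a y) -> x = y.
Proof. by move=> xy; apply: val_inj; apply: functional_extensionality_dep. Qed.

Definition invlim_cylinders : set (set (invlim S)) :=
  [set W | exists a V, open V /\ W = invlim_proj S a @^-1` V].

Lemma invlim_cylinders_basis : basis invlim_cylinders.
Proof.
have cts a := @cts_fun _ _ (invlim_proj S a).
apply: separating_basis => [_ [a [V [oV ->]]]||_ _ [a [V [oV ->]]] [b [W [oW ->]]]|].
- by apply: open_comp => // x _; exact: cts.
- have [[a _] _] := dirA; exists a, setT; split; first exact: openT.
  by rewrite preimage_setT.
- have [_ /(_ a b)[c [ac bc]]] := dirA.
  exists c, ((sys_map S ac @^-1` V) `&` (sys_map S bc @^-1` W)); split.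
    by apply: openI; apply: open_comp => // x _; exact: cts_fun.
  apply/seteqP; split=> x /=.
    by rewrite -(invlim_projP ac x) -(invlim_projP bc x).
  by move=> [Vx Wx]; rewrite -(invlim_projP ac x) -(invlim_projP bc x).
- move=> x y xy.
  have [a xya] : exists a, invlim_proj S a x <> invlim_proj S a y.
    by apply/existsNP => xy'; apply: xy; exact: invlim_eqP.
  have := @ch_hausdorff (S a); rewrite open_hausdorff.
  move=> /(_ _ _ (introN eqP xya))[[U V] /= [Ux Vy] [oU oV UV]].
  exists (invlim_proj S a @^-1` U), (invlim_proj S a @^-1` V).
  split; [by exists a, U|by exists a, V|exact: set_mem|exact: set_mem|].
  by rewrite -preimage_setI (eqP UV) preimage_set0.
Qed.

Lemma continuous_invlim (T : topologicalType) (h : T -> invlim S) :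
  (forall a, continuous (invlim_proj S a \o h)) -> continuous h.
Proof.
move=> hc t W; have [_ bas] := invlim_cylinders_basis.
move=> /bas[_ [[a [V [oV ->]]] Vht] VW].
have nV : nbhs (invlim_proj S a (h t)) V by exact: open_nbhs_nbhs.
have nhV : nbhs t [set s | V (invlim_proj S a (h s))] := hc a t V nV.
by apply: filterS nhV => s Vs; exact: VW.
Qed.

(** If this fails, then for each [b] the families that are coherent below [b]
    and have their [c]-th member outside [U] form a nonempty closed subset of
    the product. A cluster point of these sets is a thread whose [c]-th member
    is outside [U]. *)
Lemma invlim_proj_eventually (c : A) (U : set (S c)) :
  open U -> (forall x : invlim S, U (invlim_proj S c x)) ->
  exists b (cb : (c <= b)%O), forall y : S b, U (sys_map S cb y).
Proof.
move=> oU Uall; apply: contrapT => nev.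
have out b (cb : (c <= b)%O) : exists y : S b, ~ U (sys_map S cb y).
  apply: contrapT => nout; apply: nev; exists b, cb => y; apply: contrapT => nUy.
  by apply: nout; exists y.
have pt a : exists _ : S a, True.
  have [_ /(_ a c)[b [ab cb]]] := dirA.
  by have [y _] := out b cb; exists (sys_map S ab y).
pose P := prod_topology (fun a => S a).
pose T b : set P := [set x | (forall a a' (aa' : (a <= a')%O), (a' <= b)%O ->
  sys_map S aa' (x a') = x a) /\ ~ U (x c)].
have T0 b : (c <= b)%O -> T b !=set0.
  move=> cb; have [y nUy] := out b cb.
  pose x a : S a := match pselect ((a <= b)%O) with
    | left ab => sys_map S ab y
    | right _ => projT1 (cid (pt a)) end.
  have xE a (ab : (a <= b)%O) : x a = sys_map S ab y.
    by rewrite /x; case: pselect => // ab'; exact: sys_map_irr.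
  exists (x : P); split=> [a a' aa' a'b|]; last by rewrite (xE c cb).
  have ab := le_trans aa' a'b.
  by rewrite (xE a ab) (xE a' a'b) -(sys_map_comp aa' a'b ab).
have FF : ProperFilter (filter_from [set b | (c <= b)%O] T).
  apply: filter_from_proper; last by move=> b; exact: T0.
  apply: filter_from_filter; first by exists c => /=.
  move=> b b' /= cb cb'; have [_ /(_ b b')[b2 [bb2 b'b2]]] := dirA.
  exists b2; first exact: le_trans cb bb2.
  move=> x [xcoh nUx]; split; split=> // a a' aa' a'b; apply: xcoh.
    exact: le_trans a'b bb2.
  exact: le_trans a'b b'b2.
have cP : compact [set: P].
  have := @tychonoff A (fun a => S a) (fun=> setT) (fun a => @ch_compact (S a)).
  by congr compact; apply/seteqP; split.
have [x [_ clx]] := cP _ FF (filterT : filter_from _ T setT).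
have nUx : ~ U (x c).
  move=> Ux.
  have nb : nbhs x [set z : P | U (z c)].
    by apply: (@proj_continuous A (fun a => S a) c x U); exact: open_nbhs_nbhs.
  have FT : filter_from [set b | (c <= b)%O] T (T c) by exists c => /=.
  by have [z [[_ nUz] Uz]] := clx _ _ FT nb.
have xthread : threads S x.
  move=> a b ab; apply: (@ch_hausdorff (S a)) => V W nV nW.
  have n1 : nbhs x [set z : P | V (sys_map S ab (z b))].
    apply: (@proj_continuous A (fun a => S a) b x [set z | V (sys_map S ab z)]).
    exact: (@cts_fun _ _ (sys_map S ab) (x b) V nV).
  have n2 : nbhs x [set z : P | W (z a)].
    exact: (@proj_continuous A (fun a => S a) a x W nW).
  have [_ /(_ b c)[b' [bb' cb']]] := dirA.
  have FT : filter_from [set b | (c <= b)%O] T (T b') by exists b'.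
  have [z [[zcoh _] [Vz Wz]]] := clx _ _ FT (filterI n1 n2).
  by exists (z a); split=> //; rewrite -(zcoh a b ab bb').
exact: nUx (Uall (exist _ x (mem_set xthread))).
Qed.

End InverseLimits.

Section IdemInverseLimits.
Context (R : realType) d (A : preorderType d) (S : inverse_system A).
Hypothesis dirA : directed A.

(** The values of a thread on cylinder functions are well defined and monotone
    because an inequality on the limit holds, up to [e], on some stage of the
    system. *)
Lemma idem_invlim_surj (t : invlim (F_sys (idem_functor R) S)) :
  exists mu, F_invlim_map (idem_functor R) S mu = t.
Proof.
pose m a : idem_measure R (S a) := invlim_proj _ a t.
have mE a b (ab : (a <= b)%O) (psi : continuousType (S a) R) :
    m b (psi \o sys_map S ab) = m a psi.
  exact: (congr1 (fun la : idem_measure R (S a) => la psi)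
    (@invlim_projP _ _ (F_sys (idem_functor R) S) _ _ ab t)).
have psiE a b (ab : (a <= b)%O) (psi : continuousType (S a) R) x :
    psi (invlim_proj S a x) = psi (sys_map S ab (invlim_proj S b x)).
  by congr (psi _); rewrite -(invlim_projP ab x).
have mono a (psi psi' : continuousType (S a) R) :
    (forall x, psi (invlim_proj S a x) <= psi' (invlim_proj S a x)) ->
    m a psi <= m a psi'.
  move=> le; apply/ler_addgt0Pl => e e0.
  have [||b [ab leb]] := @invlim_proj_eventually _ _ _ dirA a
      [set y | psi y < e + psi' y].
  - have -> : [set y | psi y < e + psi' y] =
        (fun y => e + psi' y - psi y) @^-1` [set r | 0 < r].
      by apply/seteqP; split=> y /=; rewrite subr_gt0.
    apply: open_comp; last exact: open_gt.
    by move=> y _; apply: cvgB; [exact: (@fun_odot_cts _ _ e psi')|exact: cts_fun].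
  - by move=> x /=; rewrite (le_lt_trans (le x))// ltrDr.
  rewrite -(mE _ _ ab) -(mE _ _ ab psi') -idem_odot; apply: idem_le => y.
  exact/ltW/leb.
have [||||mu muP] := @idem_extension R (invlim S) (fun phi r =>
  exists a (psi : continuousType (S a) R),
    phi =1 psi \o invlim_proj S a /\ r = m a psi).
- move=> c; have [[a _] _] := dirA.
  by exists a, (fun_cst (S a) c); split=> //; rewrite idem_cst.
- move=> c phi r [a [psi [e ->]]]; exists a, (fun_odot c psi).
  by split=> [x|]; rewrite ?idem_odot//= /mkcts e.
- move=> phi phi' r r' [a [psi [e ->]]] [b [psi' [e' ->]]].
  have [_ /(_ a b)[c [ac bc]]] := dirA.
  exists c, (fun_oplus (psi \o sys_map S ac) (psi' \o sys_map S bc)).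
  split=> [x|]; last by rewrite idem_oplus !mE.
  by rewrite /= /mkcts e e' /= (psiE _ _ ac) (psiE _ _ bc).
- move=> phi phi' r r' [a [psi [e ->]]] [b [psi' [e' ->]]] le.
  have [_ /(_ a b)[c [ac bc]]] := dirA.
  rewrite -(mE _ _ ac) -(mE _ _ bc); apply: mono => x /=.
  by have := le x; rewrite e e' /= (psiE _ _ ac) (psiE _ _ bc).
exists mu; apply: invlim_eqP => a; apply: idem_measureP => psi.
by apply: muP; exists a, psi.
Qed.

Lemma idem_invlim_inj : injective (F_invlim_map (idem_functor R) S).
Proof.
move=> mu nu munu; apply: idem_eq_peaks => x U N nU.
have [_ bas] := invlim_cylinders_basis S dirA.
have [_ [[a [V [oV ->]]] Vx] VU] := bas x U nU.
have [h [hx hle hV]] := urysohn_peak N (conj oV Vx : open_nbhs _ V).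
exists (h \o invlim_proj S a); split=> //.
- exact: (congr1 (fun t : invlim (F_sys (idem_functor R) S) =>
    (invlim_proj _ a t : idem_measure R (S a)) h) munu).
- by move=> y; exact: hle.
- by move=> y nUy; apply: hV; apply: contra_not nUy => /VU.
Qed.

Lemma idem_invlim_homeo : homeomorphism (F_invlim_map (idem_functor R) S).
Proof.
apply: bij_continuous_homeomorphism; last 2 first.
- exact: idem_invlim_inj.
- exact: idem_invlim_surj.
apply: continuous_invlim => // a.
exact: (@cts_fun _ _ (fmor (idem_functor R) (invlim_proj S a))).
Qed.

End IdemInverseLimits.

(** * Cardinal arithmetic *)

Lemma card_le_injP (T U : Type) (A : set T) (B : set U) :
  (A #<= B)%card <-> exists f : A -> B, injective f.
Proof.
split=> [/card_leP[f]|[f fI]].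
  by exists f => x y; apply: inj; rewrite inE.
by apply/card_leP/injfunPex; exists f => // x y _ _ /fI.
Qed.

Lemma card_le_typeP (K L : Type) :
  ([set: K] #<= [set: L])%card <-> exists f : K -> L, injective f.
Proof.
split=> [/card_le_injP[f fI]|[f fI]].
  exists (fun x => set_val (f (exist _ x (mem_set I)))) => x y /val_inj/fI.
  by case.
apply/card_le_injP.
by exists (fun x => exist _ (f (set_val x)) (mem_set I)) => x y [/fI/val_inj].
Qed.

Lemma card_le_rel (T U : Type) (A : set T) (B : set U) (r : T -> U -> Prop) :
  (forall a, A a -> exists2 b, B b & r a b) ->
  (forall a a' b, A a -> A a' -> r a b -> r a' b -> a = a') ->
  (A #<= B)%card.
Proof.
move=> rtot rinj; apply/card_le_injP.
have /choice[f fP] : forall a : A, exists b : B, r (set_val a) (set_val b).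
  move=> a; have [b Bb rab] := rtot _ (set_valP a).
  by exists (exist _ b (mem_set Bb)).
exists f => a a' ff; apply: val_inj.
by apply: (rinj _ _ _ (set_valP a) (set_valP a') (fP a)); rewrite ff; exact: fP.
Qed.

(** Consider a maximal set [Phi] of choice functions on [F] of which any two
    differ at every member of [F]. As no choice function can be added, the
    values of [Phi] exhaust some member of [F], so that this member injects
    into [Phi] and hence into all the others. *)
Lemma card_min_exists (T : Type) (F : set (set T)) : F !=set0 ->
  exists2 B, F B & forall B', F B' -> (B #<= B')%card.
Proof.
move=> [B0 FB0].
pose P (Phi : set (set T -> T)) := (forall f B, Phi f -> F B -> B (f B)) /\
  (forall f g B, Phi f -> Phi g -> F B -> f B = g B -> f = g).
have [|Phi [[Phich Phiinj] Phimax]] := @Zorn_bigcup _ P.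
  move=> C CP totC; split=> [f B [X CX Xf]|f g B [X CX Xf] [Y CY Yg]].
    by have [+ _] := CP _ CX; exact.
  have [XY|YX] := totC _ _ CX CY.
    by have [_] := CP _ CY; apply=> //; exact: XY.
  by have [_] := CP _ CX; apply=> //; exact: YX.
have [B FB Bfull] : exists2 B, F B & forall b, B b -> exists2 f, Phi f & f B = b.
  apply: contrapT => nB.
  have new B : F B -> exists2 b, B b & forall f, Phi f -> f B <> b.
    move=> FB; apply: contrapT => nb; apply: nB; exists B => // b Bb.
    apply: contrapT => nf; apply: nb; exists b => // f Phif fB.
    by apply: nf; exists f.
  have [b0 _ _] := new _ FB0.
  have /choice[h hP] : forall B, exists b, F B ->
      B b /\ forall f, Phi f -> f B <> b.
    move=> B; have [FB|nFB] := pselect (F B); last by exists b0.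
    by have [b Bb bP] := new _ FB; exists b.
  apply: (Phimax (h |` Phi)); last first.
    split=> [f B [->|Phif] FB|f g B [->|Phif] [->|Phig] FB //].
    - by have [] := hP _ FB.
    - exact: Phich Phif FB.
    - by move=> hg; have [_ /(_ _ Phig)[]] := hP _ FB.
    - by move=> fh; have [_ /(_ _ Phif)[]] := hP _ FB.
    - exact: Phiinj.
  split; first by move=> f; right.
  by move=> /(_ h (or_introl erefl)) Phih; have [_ /(_ _ Phih)[]] := hP _ FB0.
exists B => // B' FB'.
apply: (@card_le_rel _ _ B B' (fun b b' => exists2 f, Phi f & b = f B /\ b' = f B')).
  move=> b Bb; have [f Phif fB] := Bfull _ Bb.
  by exists (f B'); [exact: Phich Phif FB'|exists f].
move=> b b' c _ _ [f Phif [-> ->]] [g Phig [-> fg]].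
by rewrite (Phiinj _ _ _ Phif Phig FB' fg).
Qed.

Section Square.
Variable K : Type.

Definition square_dom (G : set ((K * K) * K)) : set K :=
  [set x | exists z, G ((x, x), z)].

(** The graph of an injection [D * D -> D] with [D] the domain above, except
    that a pair may have several images. *)
Definition squaring (G : set ((K * K) * K)) : Prop :=
  [/\ forall x y z, G ((x, y), z) ->
        [/\ square_dom G x, square_dom G y & square_dom G z],
      forall x y, square_dom G x -> square_dom G y -> exists z, G ((x, y), z) &
      forall p p' z, G (p, z) -> G (p', z) -> p = p'].

(** If the complement of [D] contains a copy [h @` D] of [D], then the pairs
    from the union of [D] and this copy that are not in [D * D] consist of
    three copies of [D * D]; these are sent into [h @` D], three elements
    [c b b'] of [D] serving as tags. *)
Lemma squaring_extend (G : set ((K * K) * K)) (c : bool -> bool -> K) (h : K -> K) :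
  squaring G -> (forall b b', square_dom G (c b b')) ->
  (forall b b' d d', c b b' = c d d' -> b = d /\ b' = d') ->
  (forall x, square_dom G x -> ~ square_dom G (h x)) ->
  (forall x y, square_dom G x -> square_dom G y -> h x = h y -> x = y) ->
  exists2 H, squaring H & G `<` H.
Proof.
move=> [Gdom Gtot Ginj] cD cI hD hI.
pose s (b : bool) u := if b then h u else u.
pose H : set ((K * K) * K) := G `|` [set q | exists b b' u v w1 w,
  [/\ b || b', G ((u, v), w1), G ((c b b', w1), w) & q = ((s b u, s b' v), h w)]].
have code b b' u v : square_dom G u -> square_dom G v ->
    exists w1 w, G ((u, v), w1) /\ G ((c b b', w1), w).
  move=> Du Dv; have [w1 G1] := Gtot _ _ Du Dv.
  have [_ _ Dw1] := Gdom _ _ _ G1.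
  by have [w G2] := Gtot _ _ (cD b b') Dw1; exists w1, w.
have Htot b b' u v : square_dom G u -> square_dom G v ->
    exists z, H ((s b u, s b' v), z).
  move=> Du Dv; have [bb|] := boolP (b || b').
    have [w1 [w [G1 G2]]] := code b b' _ _ Du Dv.
    by exists (h w); right; exists b, b', u, v, w1, w.
  by case: b b' => [] [] //= _; have [z Gz] := Gtot _ _ Du Dv; exists z; left.
have HdomS b u : square_dom G u -> square_dom H (s b u).
  by move=> Du; have [z Hz] := Htot b b _ _ Du Du; exists z.
have Hdom x y z : H ((x, y), z) -> exists b u b' v b2 w,
    [/\ [/\ square_dom G u, square_dom G v & square_dom G w],
        x = s b u, y = s b' v & z = s b2 w].
  move=> [Gxyz|[b [b' [u [v [w1 [w [_ G1 G2 [-> -> ->]]]]]]]]].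
    by exists false, x, false, y, false, z; split=> //; exact: Gdom.
  exists b, u, b', v, true, w; split=> //.
  by have [? ? _] := Gdom _ _ _ G1; have [_ _ ?] := Gdom _ _ _ G2.
have sI b b' u v : square_dom G u -> square_dom G v -> s b u = s b' v ->
    b = b' /\ u = v.
  case: b b' => [] [] //= Du Dv e.
  - by split=> //; exact: hI.
  - by case: (hD _ Du); rewrite e.
  - by case: (hD _ Dv); rewrite -e.
exists H; last first.
  split; first by move=> p Gp; left.
  move=> HG; pose x := c true true.
  have [z Hz] := HdomS true x (cD _ _).
  by have [] := Gdom _ _ _ (HG _ Hz) => /(hD _ (cD _ _)).
split=> [x y z /Hdom[b [u [b' [v [b2 [w [[Du Dv Dw] -> -> ->]]]]]]]|x y|].
- by split; exact: HdomS.
- move=> [z /Hdom[b [u [_ [_ [_ [_ [[Du _ _] -> _ _]]]]]]]].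
  move=> [z' /Hdom[b' [v [_ [_ [_ [_ [[Dv _ _] -> _ _]]]]]]]].
  exact: Htot.
- have GN p z w : G (p, z) -> square_dom G w -> z = h w -> False.
    by case: p => x y /Gdom[_ _ Dz] Dw zh; apply: (hD _ Dw); rewrite -zh.
  move=> p p' z [Gp|[b [b' [u [v [w1 [w [_ G1 G2 [pE zE]]]]]]]]].
    move=> [|[d [d' [u' [v' [w1' [w' [_ G1' G2' [p'E z'E]]]]]]]]]; first exact: Ginj.
    have [_ _ Dw'] := Gdom _ _ _ G2'.
    by case: (GN _ _ _ Gp Dw' z'E).
  have [_ _ Dw] := Gdom _ _ _ G2.
  move=> [Gp'|[d [d' [u' [v' [w1' [w' [_ G1' G2' [p'E z'E]]]]]]]]].
    by case: (GN _ _ _ Gp' Dw zE).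
  have [_ _ Dw'] := Gdom _ _ _ G2'.
  have ww : w = w' by apply: hI => //; rewrite -zE.
  rewrite -ww in G2'; have [/cI[bd bd'] w11] := Ginj _ _ _ G2 G2'.
  rewrite -w11 in G1'; have [uu vv] := Ginj _ _ _ G1 G1'.
  by rewrite pE p'E bd bd' uu vv.
Qed.

(** By Zorn's lemma there is a maximal partial injection [D * D -> D] that
    extends a pairing function of a copy of [nat]. The complement of [D] cannot
    contain a copy of [D], so it injects into [D], and [K] is no larger than
    [D]. *)
Lemma infinite_card_square : infinite_set [set: K] ->
  ([set: K * K] #<= [set: K])%card.
Proof.
move=> /infiniteP/card_le_typeP[e eI].
pose G0 : set ((K * K) * K) :=
  [set q | exists i j, q = ((e i, e j), e (pickle (i, j)))].
pose P G := squaring (G0 `|` G).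
have P0 : P set0.
  rewrite /P setU0; split.
  - move=> x y z [i [j [-> -> ->]]].
    by split; eexists; eexists; eexists; reflexivity.
  - by move=> x y [_ [i [_ [-> _ _]]]] [_ [j [_ [-> _ _]]]]; exists (e (pickle (i, j))), i, j.
  - move=> p p' z [i [j [-> ->]]] [i' [j' [-> /eI /(pcan_inj pickleK) [-> ->]]]].
    by [].
have [|G [PG Gmax]] := @Zorn_bigcup _ P.
  move=> C CP totC.
  have one p : (G0 `|` \bigcup_(X in C) X) p -> exists X,
      [/\ P X, X = set0 \/ C X & (G0 `|` X) p].
    move=> [G0p|[X CX Xp]]; first by exists set0; split=> //; left.
    by exists X; split; [exact: CP|right|right].
  have two p q : (G0 `|` \bigcup_(X in C) X) p -> (G0 `|` \bigcup_(X in C) X) q ->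
      exists X, [/\ P X, X `<=` \bigcup_(X in C) X, (G0 `|` X) p & (G0 `|` X) q].
    have sub X : X = set0 \/ C X -> X `<=` \bigcup_(X in C) X.
      by move=> [->//|CX]; exact: bigcup_sup.
    move=> /one[X [PX CX Xp]] /one[Y [PY CY Yq]].
    have [XY|YX] : X `<=` Y \/ Y `<=` X.
      case: CX CY => [->|CX] [->|CY]; [by left|by left|by right|exact: totC].
      exists Y; split=> //; first exact: sub.
      by case: Xp => [?|/XY ?]; [left|right].
    exists X; split=> //; first exact: sub.
    by case: Yq => [?|/YX ?]; [left|right].
  have domS X x : X `<=` \bigcup_(X in C) X -> square_dom (G0 `|` X) x ->
      square_dom (G0 `|` \bigcup_(X in C) X) x.
    by move=> XC [z Xz]; exists z; exact: (setUS XC).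
  split.
  - move=> x y z Gq; have [X [[Xdom _ _] XC Xq _]] := two _ _ Gq Gq.
    by have [? ? ?] := Xdom _ _ _ Xq; split; apply: domS XC _.
  - move=> x y [z Gx] [z' Gy]; have [X [[_ Xtot _] XC Xx Xy]] := two _ _ Gx Gy.
    have [||w Xw] := Xtot x y; [by exists z|by exists z'|].
    by exists w; exact: (setUS XC).
  - move=> p p' z Gp Gp'; have [X [[_ _ Xinj] _ Xp Xp']] := two _ _ Gp Gp'.
    exact: Xinj Xp Xp'.
have {}Gmax H : squaring H -> ~ (G0 `|` G `<` H).
  move=> sH [GH nHG]; apply: (Gmax H); last first.
    by rewrite /P (_ : G0 `|` H = H)//; apply/setUidPr => q G0q; apply: GH; left.
  by split=> [q Gq|HG]; [apply: GH; right|apply: nHG => q /HG; right].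
have [Gdom Gtot Ginj] := PG.
set D := square_dom (G0 `|` G) in Gdom Gtot.
have De i : D (e i) by exists (e (pickle (i, i))); left; exists i, i.
have [//|B [->|->] Bmin] := @card_min_exists _ [set D; ~` D].
- by exists D; left.
- (* a copy of [D] outside [D] would contradict maximality *)
  have /card_le_injP[h hI] := Bmin (~` D) (or_intror erefl).
  pose h' x := match pselect (D x) with
    | left Dx => set_val (h (exist _ x (mem_set Dx))) | right _ => x end.
  have h'E x (Dx : D x) : h' x = set_val (h (exist _ x (mem_set Dx))).
    by rewrite /h'; case: pselect => // Dx'; rewrite (Prop_irrelevance Dx' Dx).
  have [||||H sH GH] := @squaring_extend (G0 `|` G)
    (fun b b' => e (b + b'.*2)%N) h' PG.
  + by move=> b b'; exact: De.
  + by move=> [] [] [] [] /eI.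
  + by move=> x Dx; rewrite (h'E _ Dx); exact: (set_valP (h _)).
  + by move=> x y Dx Dy; rewrite (h'E _ Dx) (h'E _ Dy) => /val_inj/hI[].
  by case: (Gmax H sH).
(* otherwise [Q x q] codes an element [x] of [K] by an element [q] of [D] *)
have /card_le_injP[h hI] := Bmin D (or_introl erefl).
pose Q x q := (D x /\ (G0 `|` G) ((e 0%N, x), q)) \/
  exists nDx : x \in ~` D, (G0 `|` G) ((e 1%N, set_val (h (exist _ x nDx))), q).
have Qtot x : exists2 q, D q & Q x q.
  have [Dx|nDx] := pselect (D x).
    have [q Gq] := Gtot _ _ (De 0%N) Dx; have [_ _ Dq] := Gdom _ _ _ Gq.
    by exists q => //; left.
  pose hx := h (exist _ x (mem_set nDx)).
  have [q Gq] := Gtot _ _ (De 1%N) (set_valP hx); have [_ _ Dq] := Gdom _ _ _ Gq.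
  by exists q => //; right; exists (mem_set nDx).
have Qinj x x' q : Q x q -> Q x' q -> x = x'.
  move=> [[Dx Gq]|[nDx Gq]] [[Dx' Gq']|[nDx' Gq']];
    have /pair_equal_spec[e01 xx] := Ginj _ _ _ Gq Gq' => //.
  - by move/eI: e01.
  - by move/eI: e01.
  - by case: (hI _ _ (val_inj xx)).
apply: (@card_le_rel _ _ _ _ (fun p z => exists q q',
  [/\ Q p.1 q, Q p.2 q' & (G0 `|` G) ((q, q'), z)])).
  move=> [x y] _; have [q Dq Qx] := Qtot x; have [q' Dq' Qy] := Qtot y.
  by have [z Gz] := Gtot _ _ Dq Dq'; exists z => //; exists q, q'.
move=> [x y] [x' y'] z _ _ [q [q' [/= Qx Qy Gz]]] [p [p' [/= Qx' Qy' Gz']]].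
have [qp qp'] := Ginj _ _ _ Gz Gz'; rewrite -{}qp -{}qp' in Qx' Qy'.
by rewrite (Qinj _ _ _ Qx Qx') (Qinj _ _ _ Qy Qy').
Qed.

Lemma infinite_card_seq : infinite_set [set: K] ->
  ([set: seq K] #<= [set: K])%card.
Proof.
move=> infK; have /card_le_typeP[j jI] := infinite_card_square infK.
have /infiniteP/card_le_typeP[e eI] := infK.
pose c := fix c (s : seq K) := if s is x :: s' then j (x, c s') else e 0%N.
apply/card_le_typeP; exists (fun s => j (e (size s), c s)) => s s' /jI[/eI].
elim: s s' => [|x s IHs] [|x' s'] //= [ss] /jI[-> cc].
by rewrite (IHs s').
Qed.

Lemma infinite_card_countable_prod (N : countType) : infinite_set [set: K] ->
  ([set: K * N] #<= [set: K])%card.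
Proof.
move=> infK; have /card_le_typeP[j jI] := infinite_card_square infK.
have /infiniteP/card_le_typeP[e eI] := infK.
apply/card_le_typeP; exists (fun p => j (p.1, e (pickle p.2))).
by move=> [x n] [x' n'] /jI[-> /eI/(pcan_inj pickleK)->].
Qed.

End Square.

(** * Weight *)

Lemma min_basis_exists (T : topologicalType) : exists B : set (set T), min_basis B.
Proof.
have [|B bB Bmin] := @card_min_exists (set T) [set B | basis B].
  by exists open; split=> // x W; rewrite nbhsE => -[V [oV Vx] VW]; exists V.
by exists B.
Qed.

Lemma infinite_basis (X : compHaus) (B : set (set X)) :
  infinite_set [set: X] -> basis B -> infinite_set B.
Proof.
move=> infX [_ Bbas] /finite_seqP[s Bs]; apply: infX.
apply: card_le_finite (finite_finset (X := [set: (size s).-tuple bool])).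
apply/card_le_typeP; exists (fun x => map_tuple (fun V : set X => `[<V x>]) (in_tuple s)).
move=> x y /(congr1 val)/= /eq_in_map xy; apply: (@ch_hausdorff X) => U W nU nW.
have [V [BV Vx] VU] := Bbas x U nU.
exists y; split; last exact: nbhs_singleton.
apply: VU; apply/asboolP; rewrite -xy; first exact/asboolP.
by move: BV; rewrite Bs.
Qed.

(** The finite intersections of the sets [O j] form a base by
    [separating_basis], and they are indexed by lists. *)
Lemma subbasis_card (X : compHaus) (J : Type) (O : J -> set X) :
  (forall j, open (O j)) ->
  (forall x y : X, x <> y ->
    exists i j, [/\ O i x, O j y & O i `&` O j = set0]) ->
  exists2 B : set (set X), basis B & (B #<= [set: seq J])%card.
Proof.
move=> Oo Osep; pose W (s : seq J) := foldr (fun j V => O j `&` V) setT s.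
have W1 j : W [:: j] = O j by rewrite /W /= setIT.
exists (range W); last exact: card_image_le.
apply: separating_basis => [_ [s _ <-]||_ _ [s _ <-] [s' _ <-]|x y /Osep].
- by elim: s => [|j s IHs] /=; [exact: openT|exact: openI].
- by exists [::].
- exists (s ++ s') => //; elim: s => [|j s IHs] /=; first by rewrite setTI.
  by rewrite IHs setIA.
- move=> [i [j [Oix Ojy Oij]]]; exists (O i), (O j); split=> //.
    by exists [:: i].
  by exists [:: j].
Qed.

Lemma embedding_basis (S T : topologicalType) (f : S -> T) (C : set (set T)) :
  embedding f -> basis C -> basis [set f @^-1` V | V in C].
Proof.
move=> [fcts fI fo] [Co Cbas]; split=> [_ [V CV <-]|x W].
  by apply: open_comp; [move=> ? _; exact: fcts|exact: Co].
rewrite nbhsE => -[U [oU Ux] UW]; have [V oV fUV] := fo U oU.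
have Vfx : V (f x).
  by have : (f @` U) (f x) by [exists x]; rewrite fUV => -[].
have [V' [CV' V'fx] V'V] := Cbas (f x) V (open_nbhs_nbhs (conj oV Vfx)).
exists (f @^-1` V'); first by split=> //; exists V'.
move=> y V'fy; apply: UW; have : (f @` U) (f y).
  by rewrite fUV; split; [exact: V'V|exists y].
by move=> [z Uz /fI <-].
Qed.

Definition dirac_idem (R : realType) (X : compHaus) (x : X) : idem_measure R X :=
  @IdemMeasure R X (fun phi => phi x) (fun c => erefl) (fun c phi => erefl)
    (fun phi psi => erefl).

Lemma dirac_idem_embedding (R : realType) (X : compHaus) :
  embedding (@dirac_idem R X : X -> idem_space R X).
Proof.
apply: inj_continuous_embedding => [x U /nbhs_weakP[n [phi [e [e0 sU]]]]|x y xy].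
  have nb : nbhs x [set y | forall i, `|phi i x - phi i y| < e].
    apply: filter_forall => i.
    by have /cvgrPdist_lt/(_ e e0) := @cts_fun _ _ (phi i) x.
  by apply: filterS nb => y yP; apply: sU => i; exact: yP.
apply: contrapT => nxy.
have [||||h [hx hy _]] := @urysohn_compHaus R X [set x] [set y] 0 1.
- exact: closed_point.
- exact: closed_point.
- by apply/seteqP; split=> // z [/= -> ].
- exact: ltr01.
have := congr1 (fun la : idem_measure R X => la h) xy; rewrite /= hx// hy//.
by move/eqP; rewrite eq_sym oner_eq0.
Qed.

(** The peaks provided by Urysohn functions for pairs from a base [B] separate
    the measures, so the sets of measures whose value at such a peak lies above
    or below a rational form a subbase. *)
Lemma idem_basis_card (R : realType) (X : compHaus) (B : set (set X)) :
  infinite_set [set: X] -> basis B ->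
  exists2 C : set (set (idem_space R X)), basis C & (C #<= B)%card.
Proof.
move=> infX bB; have [Bo Bbas] := bB.
pose K : Type := B.
have infK : infinite_set [set: K].
  move=> finK; apply: (infinite_basis infX bB).
  by apply: card_le_finite finK; have /card_eqPle[] := card_setT B.
have /choice[g gP] : forall p : (K * K) * nat, exists g : continuousType X R,
    closure (set_val p.1.1) `<=` set_val p.1.2 ->
    [/\ forall y, closure (set_val p.1.1) y -> g y = 0, forall y, g y <= 0 &
        forall y, ~ (set_val p.1.2 : set X) y -> g y <= - p.2.+1%:R].
  move=> [[U V] n] /=.
  have [UV|nUV] := pselect (closure (set_val U) `<=` set_val V); last first.
    by exists (fun_cst X 0).
  have [||||g [gV gU gle]] := @urysohn_compHaus R X (~` set_val V)
    (closure (set_val U)) (- n.+1%:R) 0.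
  - by apply: open_closedC; apply: Bo; exact: set_valP.
  - exact: closed_closure.
  - by apply/seteqP; split=> // y [nVy /UV].
  - by rewrite oppr_lt0.
  exists g => _; split=> // y; first by have /andP[] := gle y.
  by move=> nVy; rewrite gV.
pose J : Type := ((K * K) * nat * (rat * bool))%type.
pose O (j : J) : set (idem_space R X) :=
  [set mu | if j.2.2 then ratr j.2.1 < (mu : idem_measure R X) (g j.1)
            else (mu : idem_measure R X) (g j.1) < ratr j.2.1].
have Oo j : open (O j).
  case: j => p [r b]; rewrite /O /=.
  pose ev (mu : idem_space R X) : R := (mu : idem_measure R X) (g p).
  have cts : continuous ev by exact: idem_eval_cts.
  case: b.
    by apply: (@open_comp _ _ ev [set t | ratr r < t]);
      [move=> ? _; exact: cts|exact: open_gt].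
  by apply: (@open_comp _ _ ev [set t | t < ratr r]);
    [move=> ? _; exact: cts|exact: open_lt].
have sep (mu nu : idem_measure R X) : mu <> nu -> exists p, mu (g p) <> nu (g p).
  move=> munu; apply/existsNP => agree; apply: munu; apply: idem_eq_peaks => x U N.
  move=> nU; have [V [BV Vx] VU] := Bbas x U nU.
  have [W oW WV] := compHaus_regular (open_nbhs_nbhs (conj (Bo _ BV) Vx)).
  have [V' [BV' V'x] V'W] := Bbas x W (open_nbhs_nbhs oW).
  pose n := Num.truncn `|N|.
  pose p : (K * K) * nat := (exist _ V' (mem_set BV'), exist _ V (mem_set BV), n).
  have V'V : closure V' `<=` V by apply: subset_trans WV; exact: closureS.
  have [g0 gle gV] := gP p V'V.
  exists (g p); split=> //; first by apply: g0; exact: subset_closure.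
  move=> y nUy; rewrite (le_trans (gV y _))//; first by apply: contra_not nUy => /VU.
  by rewrite lerN2 (le_trans (ler_norm N))// ltW// truncnS_gt.
have sepO (mu nu : idem_space R X) (p : (K * K) * nat) :
    (mu : idem_measure R X) (g p) < (nu : idem_measure R X) (g p) ->
    exists r, [/\ O (p, (r, false)) mu, O (p, (r, true)) nu &
      O (p, (r, false)) `&` O (p, (r, true)) = set0].
  move=> /rat_in_itvoo[r]; rewrite in_itv /= => /andP[lo hi]; exists r; split=> //.
  by apply/seteqP; split=> // la [/= ltr gtr]; have := lt_trans ltr gtr; rewrite ltxx.
have [|C bC CJ] := @subbasis_card (idem_space R X) J O Oo.
  move=> mu nu /sep[p] /eqP; rewrite neq_lt => /orP[] /sepO[r [Omu Onu Odisj]].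
    by exists (p, (r, false)), (p, (r, true)).
  by exists (p, (r, true)), (p, (r, false)); split=> //; rewrite setIC.
exists C => //; apply: card_le_trans CJ _.
apply: (@card_le_trans _ _ _ [set: K]); last by have /card_eqPle[] := card_setT B.
have JK : ([set: J] #<= [set: K])%card.
  have /card_le_typeP[k kI] := infinite_card_countable_prod
    (nat * (rat * bool))%type infK.
  have /card_le_typeP[j jI] := infinite_card_square infK.
  apply/card_le_typeP.
  exists (fun q : J => k (j q.1.1, (q.1.2, q.2))) => -[[u n] q] [[u' n'] q'] /=.
  by move=> /kI[/jI-> -> ->].
have /card_le_typeP[f fI] := JK.
apply: card_le_trans (infinite_card_seq infK); apply/card_le_typeP.
by exists (map f); exact: inj_map.
Qed.

Lemma idem_same_weight (R : realType) (X : compHaus) :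
  infinite_set [set: X] -> same_weight (idem_space R X) X.
Proof.
move=> infX; have [B [bB Bmin]] := min_basis_exists X.
have [C [bC Cmin]] := min_basis_exists (idem_space R X).
exists C, B; split=> //; apply/card_eqPle; split.
  have [C' bC' C'B] := idem_basis_card R infX bB.
  exact: card_le_trans (Cmin _ bC') C'B.
have bB' := embedding_basis (@dirac_idem_embedding R X) bC.
exact: card_le_trans (Bmin _ bB') (card_image_le _ _).
Qed.

(** * Normality *)

Lemma idem_singleton (R : realType) (X : compHaus) (x : X) :
  [set: X] = [set x] ->
  [set: idem_space R X] = [set (dirac_idem R x : idem_space R X)].
Proof.
move=> X1; have eqx (y : X) : y = x by have : [set: X] y by []; rewrite X1.
apply/seteqP; split=> // mu _ /=; apply: idem_measureP => phi.
rewrite /= -[RHS](idem_cst mu); congr (idem_val mu _).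
by apply/continuousEP => y; rewrite /= (eqx y).
Qed.

(** On the empty space all constant functions coincide, so they cannot have
    different integrals. *)
Lemma idem_empty (R : realType) (X : compHaus) :
  [set: X] = set0 -> [set: idem_space R X] = set0.
Proof.
move=> X0; apply/seteqP; split=> // mu _ /=.
have e : fun_cst X (0 : R) = fun_cst X 1.
  by apply/continuousEP => x; have : [set: X] x by []; rewrite X0.
have := idem_cst (mu : idem_measure R X) 1; rewrite -e idem_cst => /eqP.
by rewrite eq_sym oner_eq0.
Qed.

Lemma supported_sub (R : realType) (X : compHaus) (mu : idem_measure R X)
    (A B : set X) : A `<=` B -> supported mu A -> supported mu B.
Proof. by move=> AB sA phi psi le; apply: sA => x /AB; exact: le. Qed.

Lemma supported_map (R : realType) (X Y : compHaus) (f : continuousType X Y)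
    (mu : idem_measure R X) (B : set Y) :
  supported mu (f @^-1` B) -> supported (idem_map R f mu : idem_measure R Y) B.
Proof. by move=> sB phi psi le; apply: sB => x; exact: le. Qed.

Theorem proposition2p12 (R : realType) : normal_functor (idem_functor R).
Proof.
split.
- by move=> d A S dirA; exact: idem_invlim_homeo.
- by move=> X; exact: idem_same_weight.
- by move=> X [x X1]; exists (dirac_idem R x); exact: idem_singleton.
- by move=> X; exact: idem_empty.
- move=> X Y f fsurj nu _; have [|mu <-] := @idem_map_surj R X Y f _ nu.
    by move=> y; have [x _ <-] := fsurj y I; exists x.
  by exists mu.
- move=> X Y f [_ fI _]; apply: inj_continuous_embedding.
    exact: cts_fun.
  exact: idem_map_inj.
- move=> X A B cA cB; apply/seteqP; split=> mu.
    by move=> /F_closed_supported sAB; split; apply/F_closed_supported;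
      apply: supported_sub sAB => x [].
  move=> [/F_closed_supported sA /F_closed_supported sB].
  apply/F_closed_supported.
  apply: (@supported_preimage R X X (@idfun X)) => //.
  exact: supported_map.
- move=> X Y f B cB; apply/seteqP; split=> mu.
    by move=> /F_closed_supported sB; apply/F_closed_supported/supported_map.
  move=> /F_closed_supported sB; apply/F_closed_supported.
  rewrite -[f @^-1` B]setTI; apply: (supported_preimage closedT cB _ sB).
  by move=> phi psi le; apply: idem_le => x; exact: le.
Qed.
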